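(* Consider a general POVM attack on two-photon SARG04: Eve uses a POVM $\{M_{\mathrm{vac}},M_0,\dots,M_{J-1}\}$ on $\mathbb{C}^2\otimes\mathbb{C}^2$ (positive operators summing to $I$, $J$ arbitrary) and, on outcome $i$, sends Bob an arbitrary qubit state $|\sigma_i\rangle$ (on outcome vac she sends nothing). The resulting unnormalized state of Alice and Bob is $$\rho_{AB}=\sum_{k=0}^{3}\sum_{i=0}^{J-1}\operatorname{Tr}_{E}\!\Big[(I_A\otimes M_i)(I_A\otimes R^k\!\otimes\! R^k)|\Psi\rangle\langle\Psi|(I_A\otimes R^{-k}\!\otimes\! R^{-k})\Big]\otimes F R^{-k}|\sigma_i\rangle\langle\sigma_i|R^{k}F^\dagger,$$ with $|\Psi\rangle=|0_z\rangle_A|\varphi_0\varphi_0\rangle_E+|1_z\rangle_A|\varphi_1\varphi_1\rangle_E$, and the induced bit error rate (when $\operatorname{Tr}\rho_{AB}>0$) is $$e_b=\frac{\langle0_z1_z|\rho_{AB}|0_z1_z\rangle+\langle1_z0_z|\rho_{AB}|1_z0_z\rangle}{\operatorname{Tr}\rho_{AB}}.$$ Then the smallest bit error rate Eve can induce by such an attack is $\frac{3-\sqrt2}{7}\approx 22.65\%$. Moreover, this minimum is attained by the POVM with $J=4$, $$M_m=|\chi_m\rangle\langle\chi_m|,\quad |\chi_m\rangle=\lambda_+|\varphi_m\rangle|\varphi_m\rangle+\lambda_-|\varphi_{m+2}\rangle|\varphi_{m+2}\rangle,\quad m=0,\dots,3,$$ $$M_{\mathrm{vac}}=\tfrac12\big(|\varphi_0\varphi_2\rangle-|\varphi_2\varphi_0\rangle\big)\big(\langle\varphi_0\varphi_2|-\langle\varphi_2\varphi_0|\big)=\tfrac12\big(|\varphi_3\varphi_1\rangle-|\varphi_1\varphi_3\rangle\big)\big(\langle\varphi_3\varphi_1|-\langle\varphi_1\varphi_3|\big),$$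 where $\lambda_\pm=(\pm2+\sqrt2)/4$, with Eve sending $|\sigma_m\rangle=|\varphi_m\rangle$ on outcome $m$; the outcome vac never occurs since the states $|\varphi_m\rangle|\varphi_m\rangle$ are orthogonal to the support of $M_{\mathrm{vac}}$.
   Context: Qubits use bases related by $|0_x\rangle=(|0_z\rangle+|1_z\rangle)/\sqrt2$, $|1_x\rangle=(|0_z\rangle-|1_z\rangle)/\sqrt2$. Let $|\varphi_0\rangle=\cos(\pi/8)|0_x\rangle+\sin(\pi/8)|1_x\rangle$, $R=\cos(\pi/4)I+\sin(\pi/4)(|1_x\rangle\langle0_x|-|0_x\rangle\langle1_x|)$, $|\varphi_m\rangle=R^{-m}|\varphi_0\rangle$ with indices taken mod 4, and $F=\sin(\pi/8)|0_x\rangle\langle0_x|+\cos(\pi/8)|1_x\rangle\langle1_x|$ (Bob's successful filtering, i.e. conclusive result). Alice emits two identical photons and applies $R^k\otimes R^k$, $k\in\{0,1,2,3\}$ uniformly; Eve intercepts both; Bob applies $R^{-k}$ then $F$ to the qubit he receives. $\operatorname{Tr}_E$ is the partial trace over the two transmitted qubits. *)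

(* Defs.v *)
From HB Require Import structures.
From mathcomp Require Import all_boot all_order all_algebra.
From mathcomp Require Import reals trigo.
From mathcomp Require Import complex mxtens.

Set Implicit Arguments.
Unset Strict Implicit.
Unset Printing Implicit Defensive.

Import Order.TTheory GRing.Theory Num.Theory.
Local Open Scope ring_scope.
Local Open Scope complex_scope.

Section QKD.
Variable R : realType.
Local Notation C := R[i].

Definition dag {m n} (A : 'M[C]_(m, n)) : 'M[C]_(n, m) := (map_mx conjc A)^T.

(* positive (semidefinite) operator: <v, A v> >= 0 for all v (in the order of C,
   which forces the value to be real) *)
Definition psd {n} (A : 'M[C]_n) : Prop := forall v : 'cV[C]_n, 0 <= (dag v *m A *m v) 0 0.

Definition is_state {n} (v : 'cV[C]_n) : Prop := (dag v *m v) 0 0 = 1.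

Definition is_povm {J : nat} (Mvac : 'M[C]_(2 * 2)) (M : 'I_J -> 'M[C]_(2 * 2)) : Prop :=
  psd Mvac /\ (forall i, psd (M i)) /\ Mvac + \sum_(i < J) M i = 1%:M.

Definition rc (x : R) : C := x%:C.

Definition ket0z : 'cV[C]_2 := delta_mx 0 0.
Definition ket1z : 'cV[C]_2 := delta_mx 1 0.
Definition ket0x : 'cV[C]_2 := (rc (Num.sqrt 2))^-1 *: (ket0z + ket1z).
Definition ket1x : 'cV[C]_2 := (rc (Num.sqrt 2))^-1 *: (ket0z - ket1z).

Definition phi0 : 'cV[C]_2 :=
  rc (cos (pi / 8)) *: ket0x + rc (sin (pi / 8)) *: ket1x.

Definition Rot : 'M[C]_2 :=
  rc (cos (pi / 4)) *: 1%:M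
  + rc (sin (pi / 4)) *: (ket1x *m dag ket0x - ket0x *m dag ket1x).

Definition phi (m : nat) : 'cV[C]_2 := Rot ^- (m %% 4) *m phi0.

Definition Filt : 'M[C]_2 :=
  rc (sin (pi / 8)) *: (ket0x *m dag ket0x) + rc (cos (pi / 8)) *: (ket1x *m dag ket1x).

Definition Psi : 'cV[C]_(2 * (2 * 2)) :=
  ket0z *t (phi 0 *t phi 0) + ket1z *t (phi 1 *t phi 1).

Definition ptrE (X : 'M[C]_(2 * (2 * 2))) : 'M[C]_2 :=
  \matrix_(a < 2, b < 2) \sum_(e < 2 * 2) X (mxtens_index (a, e)) (mxtens_index (b, e)).

Definition rhoAB {J : nat} (M : 'I_J -> 'M[C]_(2 * 2)) (sigma : 'I_J -> 'cV[C]_2)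
  : 'M[C]_(2 * 2) :=
  \sum_(k < 4) \sum_(i < J)
    ptrE ((1%:M *t M i) *m (1%:M *t (Rot ^+ k *t Rot ^+ k)) *m (Psi *m dag Psi)
          *m (1%:M *t (Rot ^- k *t Rot ^- k)))
    *t (Filt *m Rot ^- k *m (sigma i *m dag (sigma i)) *m Rot ^+ k *m dag Filt).

Definition idxAB (a b : 'I_2) : 'I_(2 * 2) := mxtens_index (a, b).

Definition ebit (rho : 'M[C]_(2 * 2)) : C :=
  (rho (idxAB 0 1) (idxAB 0 1) + rho (idxAB 1 0) (idxAB 1 0)) / \tr rho.

Definition lam_p : C := rc ((2 + Num.sqrt 2) / 4).
Definition lam_m : C := rc ((- 2 + Num.sqrt 2) / 4).

Definition chi (m : nat) : 'cV[C]_(2 * 2) :=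
  lam_p *: (phi m *t phi m) + lam_m *: (phi (m + 2) *t phi (m + 2)).

Definition M_opt (m : 'I_4) : 'M[C]_(2 * 2) := chi m *m dag (chi m).

Definition Mvac_opt : 'M[C]_(2 * 2) :=
  (2%:R)^-1 *: ((phi 0 *t phi 2 - phi 2 *t phi 0) *m dag (phi 0 *t phi 2 - phi 2 *t phi 0)).

Definition Mvac_opt' : 'M[C]_(2 * 2) :=
  (2%:R)^-1 *: ((phi 3 *t phi 1 - phi 1 *t phi 3) *m dag (phi 3 *t phi 1 - phi 1 *t phi 3)).

Definition sigma_opt (m : 'I_4) : 'cV[C]_2 := phi m.

End QKD.

(* Main.v *)
(* The four signal states are real and equally spaced, and Bob's conclusive outcomes
   project on them, so that with q_m = <phi_m phi_m|M|phi_m phi_m> and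
   p_m = |<phi_m|sigma>|^2 an outcome (M, sigma) of Eve contributes
   N = q_0 p_2 + q_1 p_3 + q_2 p_0 + q_3 p_1 to the errors and N + (sum_m q_m) / 2 to
   the trace. Hence it is enough to show N >= e (N + (sum_m q_m) / 2) for each outcome,
   with e = (3 - sqrt 2) / 7. In a suitable orthonormal basis of the symmetric subspace
   the vectors phi_m phi_m become (1, +-1, 0) / sqrt 2 and (1, 0, +-1) / sqrt 2, and the
   operator to be shown positive is, up to a positive factor, the quadratic form
   2 |v|^2 + |w|^2 - 2 sqrt 2 v (r . w) where the planar Bloch vector r = (x, y) of
   sigma satisfies |r| <= 1; it is a sum of squares. *)
Require Import Defs.
From HB Require Import structures.
From mathcomp Require Import all_boot all_order all_algebra.
From mathcomp Require Import reals trigo.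
From mathcomp Require Import complex mxtens.
From mathcomp Require Import ring lra.
Import Order.TTheory GRing.Theory Num.Theory.
Set Implicit Arguments.
Unset Strict Implicit.
Unset Printing Implicit Defensive.
Local Open Scope ring_scope.
Local Open Scope complex_scope.

Section TwoPhotonSARG04.
Variable R : realType.
Local Notation C := R[i].
Local Notation "x ^*" := (@conjc R x) : ring_scope.

(** * Trigonometric values *)

Lemma sqrt2_sq : Num.sqrt 2 * Num.sqrt 2 = 2 :> R.
Proof. by rewrite -expr2 sqr_sqrtr ?ler0n. Qed.

Lemma cos_pi4 : cos (pi / 4) = Num.sqrt 2 / 2 :> R.
Proof.
have pi0 := pi_gt0 R.
have c0 : 0 < cos (pi / 4 : R) by apply: cos_gt0_pihalf; apply/andP; split; lra.
have h0 : 0 <= Num.sqrt 2 / 2 :> R by rewrite divr_ge0 ?sqrtr_ge0.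
have E : cos (pi / 4 : R) ^+ 2 = (Num.sqrt 2 / 2) ^+ 2.
  have := cos_mulr2n (pi / 4 : R).
  have -> : (pi / 4 *+ 2 : R) = pi / 2 by field.
  have := sqrt2_sq; rewrite cos_pihalf; lra.
by apply/eqP; rewrite -(eqrXn2 (n:=2)) ?E ?eqxx // ltW.
Qed.

Lemma sin_pi4 : sin (pi / 4) = Num.sqrt 2 / 2 :> R.
Proof.
have -> : (pi / 4 : R) = pi / 2 - pi / 4 by field.
by rewrite sinB sin_pihalf cos_pihalf cos_pi4 mul0r subr0 mul1r.
Qed.

Lemma double_cos_pi8_sq : (2 * cos (pi / 8)) * (2 * cos (pi / 8)) = 2 + Num.sqrt 2 :> R.
Proof.
have := cos_mulr2n (pi / 8 : R).
have -> : (pi / 8 *+ 2 : R) = pi / 4 by field.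
by rewrite cos_pi4; lra.
Qed.

Lemma cos_pi8_neq0 : cos (pi / 8) != 0 :> R.
Proof.
have pi0 := pi_gt0 R.
by apply: lt0r_neq0; apply: cos_gt0_pihalf; apply/andP; split; lra.
Qed.

(** The double angle formula for sin(pi/4) and the known square of cos(pi/8) give tan(pi/8) = sqrt 2
    - 1. All coordinates below can therefore be written with sqrt 2 and cos(pi/8) alone. *)
Lemma sin_pi8 : sin (pi / 8) = (Num.sqrt 2 - 1) * cos (pi / 8) :> R.
Proof.
apply: (mulIf cos_pi8_neq0).
have : sin (pi / 4 : R) = sin (pi / 8) * cos (pi / 8) + cos (pi / 8) * sin (pi / 8).
  by rewrite -sinD; congr sin; field.
rewrite sin_pi4 => E; have tt := sqrt2_sq; have := double_cos_pi8_sq.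
move: (Num.sqrt 2) (cos _) (sin _) tt E => t c s tt E dc.
have -> : s * c = t / 4 by lra.
have -> : (t - 1) * c * c = (t - 1) * (2 * c * (2 * c)) / 4 by field.
by rewrite dc; field: tt.
Qed.

(** * The vectors and operators in the z basis *)

Lemma conjc_rc (x : R) : (rc x)^* = rc x.
Proof. exact: conjc_real. Qed.

Lemma conjcD (x y : C) : (x + y)^* = x^* + y^*.
Proof. exact: (rmorphD (@conjc R)). Qed.
Lemma conjcB (x y : C) : (x - y)^* = x^* - y^*.
Proof. exact: (rmorphB (@conjc R)). Qed.
Lemma conjcN (x : C) : (- x)^* = - x^*.
Proof. exact: (rmorphN (@conjc R)). Qed.
Lemma conj_opp (x : C) : x^* = x -> (- x)^* = - x.
Proof. by move=> xr; rewrite -[in RHS]xr; exact: conjcN. Qed.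
Lemma conjcM (x y : C) : (x * y)^* = x^* * y^*.
Proof. exact: (rmorphM (@conjc R)). Qed.

Lemma conj_sub_mul (a b c d : C) : a^* = a -> b^* = b -> c^* = c -> d^* = d ->
  (a * b - c * d)^* = a * b - c * d.
Proof. by move=> ar br cr dr; rewrite conjcB (conjcM a) (conjcM c) ar br cr dr. Qed.

Lemma conj_add_mul (a b c d : C) : a^* = a -> b^* = b -> c^* = c -> d^* = d ->
  (a * b + c * d)^* = a * b + c * d.
Proof. by move=> ar br cr dr; rewrite conjcD (conjcM a) (conjcM c) ar br cr dr. Qed.

Lemma conj_comb (x y a b c d : C) : x^* = x -> y^* = y ->
  a^* = a -> b^* = b -> c^* = c -> d^* = d ->
  (x * (a * b) + y * (c * d))^* = x * (a * b) + y * (c * d).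
Proof.
move=> xr yr ar br cr dr.
by rewrite conjcD (conjcM x) (conjcM y) (conjcM a) (conjcM c) xr yr ar br cr dr.
Qed.

Lemma rcD (x y : R) : rc (x + y) = rc x + rc y. Proof. exact: rmorphD. Qed.
Lemma rcB (x y : R) : rc (x - y) = rc x - rc y. Proof. exact: rmorphB. Qed.
Lemma rcM (x y : R) : rc (x * y) = rc x * rc y. Proof. exact: rmorphM. Qed.
Lemma rcV (x : R) : rc x^-1 = (rc x)^-1. Proof. exact: fmorphV. Qed.
Lemma rc_nat n : rc n%:R = n%:R :> C. Proof. exact: rmorph_nat. Qed.

Definition sqrt2C : C := rc (Num.sqrt 2).
(* Unlike cos (pi / 8), its double has a square that is integral over sqrt 2,
   which is the form of hypothesis that [field] accepts. *)
Definition cos8D : C := rc (2 * cos (pi / 8)).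

Lemma sqrt2C_sq : sqrt2C * sqrt2C = 2.
Proof. by rewrite /sqrt2C -rcM sqrt2_sq rc_nat. Qed.

Lemma cos8D_sq : cos8D * cos8D = 2 + sqrt2C.
Proof. by rewrite /cos8D -rcM double_cos_pi8_sq rcD !rc_nat. Qed.

Lemma rc_cos_pi8 : rc (cos (pi / 8)) = cos8D / 2.
Proof. by rewrite /cos8D rcM rc_nat mulrAC divff ?mul1r // pnatr_eq0. Qed.

Lemma rc_sin_pi8 : rc (sin (pi / 8)) = (sqrt2C - 1) * cos8D / 2.
Proof. by rewrite sin_pi8 rcM rcB rc_cos_pi8 mulrA (rc_nat 1). Qed.

Lemma conj_sqrt2C : sqrt2C^* = sqrt2C. Proof. exact: conjc_rc. Qed.

Lemma sqrt2C_neq0 : sqrt2C != 0.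
Proof.
apply/eqP => E; have := sqrt2C_sq; rewrite E mul0r => /esym/eqP.
by rewrite pnatr_eq0.
Qed.

Lemma sqrt2C_inv : sqrt2C^-1 = sqrt2C / 2.
Proof.
by apply: (mulfI sqrt2C_neq0); rewrite divff ?sqrt2C_neq0 // mulrA sqrt2C_sq divff // pnatr_eq0.
Qed.

Lemma dag_mul m n p (A : 'M[C]_(m, n)) (B : 'M[C]_(n, p)) :
  dag (A *m B) = dag B *m dag A.
Proof. by rewrite /dag map_mxM trmx_mul. Qed.

Lemma dagK m n (A : 'M[C]_(m, n)) : dag (dag A) = A.
Proof. by apply/matrixP => i j; rewrite !mxE conjcK. Qed.

Lemma dagD m n (A B : 'M[C]_(m, n)) : dag (A + B) = dag A + dag B.
Proof. by rewrite /dag map_mxD linearD. Qed.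

Lemma dagN m n (A : 'M[C]_(m, n)) : dag (- A) = - dag A.
Proof. by apply/matrixP => i j; rewrite !mxE; exact: conjcN. Qed.

Lemma dagZ m n a (A : 'M[C]_(m, n)) : dag (a *: A) = a^* *: dag A.
Proof. by rewrite /dag map_mxZ linearZ. Qed.

Lemma dag_tens m n p q (A : 'M[C]_(m, n)) (B : 'M[C]_(p, q)) :
  dag (A *t B) = dag A *t dag B.
Proof. by rewrite /dag map_mxT trmx_tens. Qed.

Lemma dag1 n : dag 1%:M = 1%:M :> 'M[C]_n.
Proof. by rewrite /dag map_mx1 trmx1. Qed.

(** * Explicit two-by-two matrices and coordinates in the z basis *)

Definition mx2 (a b c d : C) : 'M[C]_2 :=
  \matrix_(i < 2, j < 2) if i == 0 then (if j == 0 then a else b)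
                         else (if j == 0 then c else d).
Definition cv2 (a b : C) : 'cV[C]_2 := \col_(i < 2) if i == 0 then a else b.

Lemma ord2P (P : 'I_2 -> Prop) : P 0 -> P 1 -> forall i, P i.
Proof.
move=> P0 P1 i; case: (@eqVneq _ i 0) => [-> //|ne].
have -> // : i = 1 by apply/val_inj; case: i ne => [[|[|]]].
Qed.

Lemma sum2 (F : 'I_2 -> C) : \sum_i F i = F 0 + F 1.
Proof.
rewrite big_ord_recl big_ord_recl big_ord0 addr0; congr (_ + F _).
exact/val_inj.
Qed.

Lemma dag_mx2 a b c d : dag (mx2 a b c d) = mx2 a^* c^* b^* d^*.
Proof. by apply/matrixP; apply: ord2P; apply: ord2P; rewrite !mxE. Qed.

Lemma mul_mx2 a b c d a' b' c' d' : mx2 a b c d *m mx2 a' b' c' d' =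
  mx2 (a * a' + b * c') (a * b' + b * d') (c * a' + d * c') (c * b' + d * d').
Proof. by apply/matrixP; apply: ord2P; apply: ord2P; rewrite !mxE sum2 !mxE. Qed.

Lemma mul_mx2_cv2 a b c d x y : mx2 a b c d *m cv2 x y = cv2 (a * x + b * y) (c * x + d * y).
Proof. by apply/matrixP; apply: ord2P => j; rewrite !mxE sum2 !mxE. Qed.

Lemma mx2_scalar a : a%:M = mx2 a 0 0 a.
Proof. by apply/matrixP; apply: ord2P; apply: ord2P; rewrite !mxE. Qed.

Lemma add_mx2 a b c d a' b' c' d' :
  mx2 a b c d + mx2 a' b' c' d' = mx2 (a + a') (b + b') (c + c') (d + d').
Proof. by apply/matrixP; apply: ord2P; apply: ord2P; rewrite !mxE. Qed.

Lemma opp_mx2 a b c d : - mx2 a b c d = mx2 (- a) (- b) (- c) (- d).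
Proof. by apply/matrixP; apply: ord2P; apply: ord2P; rewrite !mxE. Qed.

Lemma scale_mx2 x a b c d : x *: mx2 a b c d = mx2 (x * a) (x * b) (x * c) (x * d).
Proof. by apply/matrixP; apply: ord2P; apply: ord2P; rewrite !mxE. Qed.

Lemma add_cv2 a b a' b' : cv2 a b + cv2 a' b' = cv2 (a + a') (b + b').
Proof. by apply/matrixP; apply: ord2P => j; rewrite !mxE. Qed.

Lemma scale_cv2 x a b : x *: cv2 a b = cv2 (x * a) (x * b).
Proof. by apply/matrixP; apply: ord2P => j; rewrite !mxE. Qed.

Lemma outer_cv2 a b c d : c^* = c -> d^* = d ->
  cv2 a b *m dag (cv2 c d) = mx2 (a * c) (a * d) (b * c) (b * d).
Proof.
move=> cr dr; apply/matrixP; apply: ord2P; apply: ord2P;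
by rewrite !mxE big_ord1 !mxE /= ?cr ?dr.
Qed.

Lemma conj_half_sqrt2C : (sqrt2C / 2)^* = sqrt2C / 2.
Proof. by rewrite /sqrt2C -(rc_nat 2) -rcV -rcM conjc_rc. Qed.

Lemma conj_cos : (cos8D / 2)^* = cos8D / 2.
Proof. by rewrite -(rc_nat 2) -rcV -!rcM conjc_rc. Qed.

Lemma conj_sin : ((sqrt2C - 1) * cos8D / 2)^* = (sqrt2C - 1) * cos8D / 2.
Proof.
have r1 : rc (1 : R) = 1 by exact: (rc_nat 1).
by rewrite -(rc_nat 2) -rcV -r1 -rcB -!rcM conjc_rc.
Qed.

Lemma ket0xE : ket0x R = cv2 (sqrt2C / 2) (sqrt2C / 2).
Proof.
rewrite /ket0x -/sqrt2C sqrt2C_inv; apply/matrixP; apply: ord2P => j; rewrite ord1 !mxE /=.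
all: by rewrite ?addr0 ?add0r mulr1.
Qed.

Lemma ket1xE : ket1x R = cv2 (sqrt2C / 2) (- (sqrt2C / 2)).
Proof.
rewrite /ket1x -/sqrt2C sqrt2C_inv; apply/matrixP; apply: ord2P => j; rewrite ord1 !mxE /=.
all: by rewrite ?subr0 ?sub0r ?mulrN mulr1.
Qed.

Lemma conj_opp_half_sqrt2C : (- (sqrt2C / 2))^* = - (sqrt2C / 2).
Proof. exact: conj_opp conj_half_sqrt2C. Qed.

(** [Rot] turns by pi/4 in the x basis; the Hadamard change of basis has determinant -1, so in z
    coordinates it turns by -pi/4. Hence [phi m] lies at angle pi/8 + m pi/4. *)
Lemma Rot_mx : Rot R = mx2 (sqrt2C / 2) (sqrt2C / 2) (- (sqrt2C / 2)) (sqrt2C / 2).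
Proof.
rewrite /Rot ket0xE ket1xE !outer_cv2 ?conj_half_sqrt2C ?conj_opp_half_sqrt2C //.
rewrite cos_pi4 sin_pi4 rcM rcV rc_nat -/sqrt2C mx2_scalar opp_mx2 add_mx2 !scale_mx2 add_mx2.
have t := sqrt2C_sq; move: sqrt2C t => g t; congr mx2; by field: t.
Qed.

(** The Hadamard matrix is the reflection in the line at angle pi/8, so it fixes [phi0]: the
    coordinates are the same in the x and z bases. *)
Lemma phi0_cv : phi0 R = cv2 (cos8D / 2) ((sqrt2C - 1) * cos8D / 2).
Proof.
rewrite /phi0 ket0xE ket1xE rc_sin_pi8 rc_cos_pi8 !scale_cv2 add_cv2.
have t := sqrt2C_sq; move: sqrt2C cos8D t => g d t; congr cv2; by field: t.
Qed.

Lemma Filt_mx : Filt R =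
  mx2 (sqrt2C * cos8D / 4) ((sqrt2C - 2) * cos8D / 4)
      ((sqrt2C - 2) * cos8D / 4) (sqrt2C * cos8D / 4).
Proof.
rewrite /Filt ket0xE ket1xE !outer_cv2 ?conj_half_sqrt2C ?conj_opp_half_sqrt2C //.
rewrite rc_sin_pi8 rc_cos_pi8 !scale_mx2 add_mx2.
have t := sqrt2C_sq; move: sqrt2C cos8D t => g d t; congr mx2; by field: t.
Qed.

Lemma dag_Rot_mx : dag (Rot R) = mx2 (sqrt2C / 2) (- (sqrt2C / 2)) (sqrt2C / 2) (sqrt2C / 2).
Proof.
by rewrite Rot_mx dag_mx2 conj_half_sqrt2C conj_opp_half_sqrt2C.
Qed.

Lemma RotV : (Rot R)^-1 = dag (Rot R).
Proof.
have E : Rot R * dag (Rot R) = 1.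
  rewrite -mulmxE dag_Rot_mx Rot_mx mul_mx2 -idmxE mx2_scalar.
  have t := sqrt2C_sq; move: sqrt2C t => g t; congr mx2; by field: t.
have [U _] := mulmx1_unit E.
by apply: (mulrI (x := Rot R)) => //; rewrite E divrr.
Qed.

Lemma dag_Rot k : dag (Rot R ^+ k) = Rot R ^- k.
Proof.
elim: k => [|k IH]; first by rewrite expr0 invr1 dag1.
by rewrite -exprVn [in LHS]exprS exprSr -mulmxE dag_mul IH exprVn RotV.
Qed.

Lemma Rot4 : Rot R ^+ 4 = - 1.
Proof.
rewrite !exprS expr0 mulr1 Rot_mx -!mulmxE !mul_mx2 -idmxE mx2_scalar opp_mx2.
have t := sqrt2C_sq; move: sqrt2C t => g t; congr mx2; by field: t.
Qed.

(** * Matrix elements of the joint state *)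

Definition qform n (A : 'M[C]_n) (v : 'cV[C]_n) : C := (dag v *m A *m v) 0 0.

Lemma qform_scale n (A : 'M[C]_n) a v :
  a^* = a -> qform A (a *: v) = a * a * qform A v.
Proof.
move=> ar; rewrite /qform dagZ -!scalemxAl -scalemxAr scalerA [LHS]mxE.
by congr (_ * _ * _).
Qed.

Lemma qformN n (A : 'M[C]_n) v : qform A (- v) = qform A v.
Proof.
by rewrite /qform dagN !mulNmx mulmxN opprK.
Qed.

Lemma qform_sign n (A : 'M[C]_n) e v : qform A ((-1) ^+ e *: v) = qform A v.
Proof.
by rewrite -signr_odd; case: odd; rewrite ?expr0 ?expr1 ?scale1r // scaleN1r qformN.
Qed.

Lemma qform_rank1 n (u v : 'cV[C]_n) :
  qform (u *m dag u) v = (dag v *m u) 0 0 * ((dag v *m u) 0 0)^*.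
Proof.
rewrite /qform mulmxA -mulmxA [LHS]mxE big_ord1.
by rewrite -[in dag u *m v](dagK v) -dag_mul !mxE.
Qed.

Lemma qform_rank1_real n (u v : 'cV[C]_n) z :
  (dag v *m u) 0 0 = z -> z^* = z -> qform (u *m dag u) v = z * z.
Proof. by move=> uv zr; rewrite qform_rank1 uv zr. Qed.

Lemma psd_scale n a (A : 'M[C]_n) : 0 <= a -> psd A -> psd (a *: A).
Proof. by move=> a0 A0 v; rewrite -scalemxAr -scalemxAl mxE mulr_ge0. Qed.

Lemma psd_rank1 n (u : 'cV[C]_n) : psd (u *m dag u).
Proof. by move=> v; rewrite -/(qform _ v) qform_rank1 mulcJ_ge0. Qed.

(** Moves the operators applied to a state onto the vector it is measured against, so that filter
    and rotation act on basis vectors. *)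
Lemma diag_conj_qform n (A X : 'M[C]_n) b :
  (A *m X *m dag A) b b = qform X (dag A *m delta_mx b 0).
Proof.
rewrite /qform dag_mul dagK; have -> : dag (delta_mx b 0 : 'cV[C]_n) = delta_mx 0 b.
  by apply/matrixP => i j; rewrite !mxE andbC; case: (_ && _); rewrite ?conjc1 ?conjc0.
have E (B : 'M[C]_n) : B b b = ((delta_mx 0 b : 'rV[C]_n) *m B *m (delta_mx b 0 : 'cV[C]_n)) 0 0.
  by rewrite -rowE -colE !mxE.
by rewrite E !mulmxA.
Qed.

(** * Action of the rotations on the signal states *)

Lemma phi_mod m n : m = n %[mod 4] -> phi R m = phi R n.
Proof. by rewrite /phi => ->. Qed.

Lemma Rot_unit : Rot R \is a GRing.unit.
Proof.
have E : Rot R ^+ 4 \is a GRing.unit by rewrite Rot4 unitrN1.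
by rewrite unitrX_pos in E.
Qed.

Lemma RotVX_phi0 n : Rot R ^- n *m phi0 R = (-1) ^+ (n %/ 4) *: phi R n.
Proof.
rewrite /phi {1}(divn_eq n 4) -!exprVn exprD mulnC exprM [_ ^+ 4]exprVn Rot4 invrN1.
rewrite -[in LHS]signr_odd -[in RHS]signr_odd; case: odd => /=.
  by rewrite !expr1 mulN1r scaleN1r mulNmx.
by rewrite !expr0 mul1r scale1r.
Qed.

(* The sign is unavoidable: [Rot] has order 8 while the indices of [phi] are taken
   modulo 4. *)
Lemma Rot_phi k m : (k <= 4)%N ->
  exists e, Rot R ^+ k *m phi R m = (-1) ^+ e *: phi R (m + 4 - k).
Proof.
move=> k4.
(* Four extra inverse rotations cost only a sign and make the exponent at least k, so the
   subtraction below does not truncate. *)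
have E : phi R m = - (Rot R ^- (m %% 4 + 4) *m phi0 R).
  rewrite /phi -!exprVn exprD [_ ^+ 4]exprVn Rot4 invrN1 mulrN1.
  by rewrite mulNmx opprK.
rewrite E mulmxN mulmxA.
have -> : Rot R ^+ k *m Rot R ^- (m %% 4 + 4) = Rot R ^- (m %% 4 + 4 - k).
  have kn : (k <= m %% 4 + 4)%N := leq_trans k4 (leq_addl _ _).
  rewrite -!exprVn -{1}(subnKC kn) exprD mulmxE mulrA exprVn divrr ?mul1r //.
  by rewrite unitrX ?Rot_unit.
rewrite RotVX_phi0; exists ((m %% 4 + 4 - k) %/ 4).+1.
rewrite exprS mulN1r scaleNr; congr (- (_ *: _)); apply: phi_mod.
by rewrite -!addnBA // modnDml.
Qed.

Definition phi_pair (m : nat) : 'cV[C]_(2 * 2) := phi R m *t phi R m.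

(** The sign left by [Rot_phi] occurs in both factors and squares to 1. The index is [m + 4 - k]
    instead of [m - k] to stay within natural numbers. *)
Lemma RotRot_phi_pair k m : (k <= 4)%N ->
  (Rot R ^+ k *t Rot R ^+ k) *m phi_pair m = phi_pair (m + 4 - k).
Proof.
move=> k4; have [e E] := Rot_phi m k4.
transitivity ((Rot R ^+ k *m phi R m) *t (Rot R ^+ k *m phi R m)).
  exact: (tensmx_mul (Rot R ^+ k) (Rot R ^+ k) (phi R m) (phi R m)).
by rewrite E; apply/matrixP => i j; rewrite !mxE mulrACA -expr2 sqrr_sign mul1r.
Qed.

Lemma tens_cvE m n (u : 'cV[C]_m) (v : 'cV[C]_n) i j :
  (u *t v) (mxtens_index (i, j)) 0 = u i 0 * v j 0.
Proof. by rewrite -tensmxE; congr (fun_of_matrix _ _ _); apply/val_inj. Qed.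

Lemma outer_entry m n (u : 'cV[C]_m) (v : 'cV[C]_n) i j :
  (u *m dag v) i j = u i 0 * (v j 0)^*.
Proof. by rewrite mxE big_ord1 !mxE. Qed.

Lemma qform_sum n (A : 'M[C]_n) v : qform A v = \sum_e (A *m v) e 0 * (v e 0)^*.
Proof. by rewrite /qform -mulmxA mxE; apply: eq_bigr => e _; rewrite !mxE mulrC. Qed.

Lemma tens1_ket_sum (B : 'M[C]_(2 * 2)) (x y : 'cV[C]_(2 * 2)) (a : 'I_2) e :
  ((1%:M *t B) *m (ket0z R *t x + ket1z R *t y)) (mxtens_index (a, e)) 0 =
  (B *m (if a == 0 then x else y)) e 0.
Proof.
have T (k : 'cV[C]_2) (u : 'cV[C]_(2 * 2)) : (1%:M *t B) *m (k *t u) = k *t (B *m u).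
  by rewrite (tensmx_mul 1%:M B k u) mul1mx.
rewrite mulmxDr !T [LHS]mxE 2!tens_cvE; move: a; apply: ord2P.
- have -> : ket0z R 0 0 = 1 by rewrite mxE.
  have -> : ket1z R 0 0 = 0 by rewrite mxE.
  by rewrite mul1r mul0r addr0.
- have -> : ket0z R 1 0 = 0 by rewrite mxE.
  have -> : ket1z R 1 0 = 1 by rewrite mxE.
  by rewrite mul1r mul0r add0r.
Qed.

(** Finding Alice's qubit in state a selects the branch [phi_pair a] of [Psi]; tracing M against the
    rotated projector on that branch is a quadratic form of M. *)
Lemma ptrE_Psi M (U : 'M[C]_(2 * 2)) (a : 'I_2) :
  ptrE ((1%:M *t M) *m (1%:M *t U) *m (Psi R *m dag (Psi R)) *m (1%:M *t dag U)) a a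
  = qform M (U *m phi_pair a).
Proof.
have dU : (1%:M *t dag U) = dag (1%:M *t U) :> 'M[C]_(2 * (2 * 2)).
  by rewrite dag_tens dag1.
have MU : (1%:M *t M) *m (1%:M *t U) = 1%:M *t (M *m U) :> 'M[C]_(2 * (2 * 2)).
  by rewrite (tensmx_mul 1%:M M 1%:M U) mul1mx.
rewrite dU MU mulmxA -[_ *m _ *m dag (1%:M *t U)]mulmxA -dag_mul.
have Y (B : 'M[C]_(2 * 2)) (e : 'I_(2 * 2)) :
    ((1%:M *t B) *m Psi R) (mxtens_index (a, e)) 0 = (B *m phi_pair a) e 0.
  apply: etrans (tens1_ket_sum _ _ _ _ _) _.
  by move: a; apply: ord2P.
rewrite mxE qform_sum; apply: eq_bigr => e _.
by rewrite outer_entry !Y mulmxA.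
Qed.

Lemma phi0E : phi R 0 = cv2 (cos8D / 2) ((sqrt2C - 1) * cos8D / 2).
Proof. by rewrite /phi expr0 invr1 mul1mx phi0_cv. Qed.

Lemma phiS m : (m < 3)%N -> phi R m.+1 = dag (Rot R) *m phi R m.
Proof.
move=> m3; rewrite /phi !modn_small ?(ltnW m3) // -?exprVn ?exprS.
  by rewrite -mulmxE -mulmxA RotV.
exact: leq_trans m3 _.
Qed.

Lemma phi1E : phi R 1 = cv2 ((sqrt2C - 1) * cos8D / 2) (cos8D / 2).
Proof.
rewrite phiS // phi0E dag_Rot_mx mul_mx2_cv2.
have t := sqrt2C_sq; move: sqrt2C cos8D t => g d t; congr cv2; by field: t.
Qed.

Lemma phi2E : phi R 2 = cv2 (- ((sqrt2C - 1) * cos8D / 2)) (cos8D / 2).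
Proof.
rewrite phiS // phi1E dag_Rot_mx mul_mx2_cv2.
have t := sqrt2C_sq; move: sqrt2C cos8D t => g d t; congr cv2; by field: t.
Qed.

Lemma phi3E : phi R 3 = cv2 (- (cos8D / 2)) ((sqrt2C - 1) * cos8D / 2).
Proof.
rewrite phiS // phi2E dag_Rot_mx mul_mx2_cv2.
have t := sqrt2C_sq; move: sqrt2C cos8D t => g d t; congr cv2; by field: t.
Qed.

Lemma dag_Filt : dag (Filt R) = Filt R.
Proof.
have E x : (rc x * cos8D / 4 : C)^* = rc x * cos8D / 4.
  by rewrite /cos8D -(rc_nat 4) -rcV -!rcM conjc_rc.
by rewrite Filt_mx dag_mx2 E -(rc_nat 2) -rcB E.
Qed.

(* Filtering and then finding bit [b] amounts to projecting on [phi (3 - b)]: the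
   conclusive outcome excludes the state orthogonal to it. *)
Lemma dag_Filt_delta (b : 'I_2) :
  exists e, dag (Filt R) *m delta_mx b 0 = (-1) ^+ e *: (sqrt2C / 2 *: phi R (3 - b)).
Proof.
rewrite dag_Filt Filt_mx.
have E0 : delta_mx 0 0 = cv2 1 0 :> 'cV[C]_2.
  by apply/matrixP; apply: ord2P => j; rewrite ord1 !mxE.
have E1 : delta_mx 1 0 = cv2 0 1 :> 'cV[C]_2.
  by apply/matrixP; apply: ord2P => j; rewrite ord1 !mxE.
have t := sqrt2C_sq; move: b; apply: ord2P.
- exists 1%N; rewrite E0 phi3E mul_mx2_cv2 expr1 !scale_cv2.
  by move: sqrt2C cos8D t => g d t; congr cv2; field: t.
- exists 0%N; rewrite E1 phi2E mul_mx2_cv2 expr0 !scale_cv2.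
  by move: sqrt2C cos8D t => g d t; congr cv2; field: t.
Qed.

(** Both the errors and the trace are read off the diagonal. Each term is Eve's weight on the pair
    that Alice sent times Bob's overlap with the state singled out by the filter; the factor 1/2 is
    the square of [sqrt2C / 2] from [dag_Filt_delta]. *)
Lemma rho_diag (J : nat) (M : 'I_J -> 'M[C]_(2 * 2)) (sigma : 'I_J -> 'cV[C]_2) (a b : 'I_2) :
  rhoAB M sigma (idxAB a b) (idxAB a b) =
  \sum_(k < 4) \sum_(i < J) qform (M i) (phi_pair (a + 4 - k)) *
     (qform (sigma i *m dag (sigma i)) (phi R (3 - b + 4 - k)) / 2).
Proof.
rewrite /rhoAB summxE; apply: eq_bigr => k _.
rewrite summxE; apply: eq_bigr => i _.
rewrite /idxAB tensmxE; congr (_ * _).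
  have <- : dag (Rot R ^+ k *t Rot R ^+ k) = Rot R ^- k *t Rot R ^- k.
    by rewrite dag_tens dag_Rot.
  by rewrite ptrE_Psi RotRot_phi_pair // ltnW.
have -> : Filt R *m Rot R ^- k *m (sigma i *m dag (sigma i)) *m Rot R ^+ k *m dag (Filt R)
   = (Filt R *m Rot R ^- k) *m (sigma i *m dag (sigma i)) *m dag (Filt R *m Rot R ^- k).
  by rewrite dag_mul -dag_Rot dagK !mulmxA.
rewrite diag_conj_qform dag_mul -dag_Rot dagK -mulmxA.
have [e ->] := dag_Filt_delta b.
have [e' E] := Rot_phi (3 - b) (ltnW (ltn_ord k)).
rewrite -!scalemxAr E qform_sign (qform_scale _ _ conj_half_sqrt2C) qform_sign mulrC.
by congr (_ * _); have t := sqrt2C_sq; move: sqrt2C t => g t; field: t.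
Qed.

(** * Error and detection rates *)

Lemma sum22 (F : 'I_(2 * 2) -> C) :
  \sum_i F i = F (idxAB 0 0) + F (idxAB 0 1) + F (idxAB 1 0) + F (idxAB 1 1).
Proof.
rewrite !big_ord_recl big_ord0 addr0 !addrA.
congr (F _ + F _ + F _ + F _); exact/val_inj.
Qed.

Lemma sum4 (F : 'I_4 -> C) : \sum_i F i = F 0 + F 1 + F 2 + F 3.
Proof.
rewrite !big_ord_recl big_ord0 addr0 !addrA.
congr (F _ + F _ + F _ + F _); exact/val_inj.
Qed.

(** * Overlaps of a resent state with the four signal states *)

Section Bloch.
Variable s : 'cV[C]_2.
Hypothesis s1 : is_state s.
Local Notation P m := (qform (s *m dag s) (phi R m)).
Local Notation a := (s 0 0).
Local Notation b := (s 1 0).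

Lemma state_norm : a * a^* + b * b^* = 1.
Proof. by move: s1; rewrite /is_state mxE sum2 !mxE => <-; ring. Qed.

Lemma qform_real2 x y : x^* = x -> y^* = y ->
  qform (s *m dag s) (cv2 x y) = (x * a + y * b) * (x * a^* + y * b^*).
Proof.
move=> xr yr; rewrite qform_rank1 mxE sum2 !mxE /=.
rewrite xr yr; congr (_ * _).
rewrite conjcD !conjcM /=.
by congr (_ * _ + _ * _).
Qed.

Definition phiE := (phi0E, phi1E, phi2E, phi3E).

(** The angles of [phi 0] and [phi 2] differ by pi/2, so the two form an orthonormal basis; likewise
    [phi 1] and [phi 3] below. *)
Lemma overlap02 : P 0 + P 2 = 1.
Proof.
rewrite !phiE !qform_real2 ?conj_opp ?conj_cos ?conj_sin //.
have [[t u] v] := (sqrt2C_sq, cos8D_sq, state_norm).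
move: sqrt2C cos8D a b (a^*) (b^*) t u v => g d x y x' y' t u v.
by rewrite -[RHS]v; field: t u.
Qed.

Lemma overlap13 : P 1 + P 3 = 1.
Proof.
rewrite !phiE !qform_real2 ?conj_opp ?conj_cos ?conj_sin //.
have [[t u] v] := (sqrt2C_sq, cos8D_sq, state_norm).
move: sqrt2C cos8D a b (a^*) (b^*) t u v => g d x y x' y' t u v.
by rewrite -[RHS]v; field: t u.
Qed.

(* The pair [(P 0 - P 2, P 1 - P 3)] is the projection of the Bloch vector of [s]
   on the plane of the four signal states. *)
Lemma bloch : 0 <= 1 - (P 0 - P 2) ^+ 2 - (P 1 - P 3) ^+ 2.
Proof.
(* The right side is (2 Im(a^* b))^2, the square of the remaining Bloch component. *)
have -> : 1 - (P 0 - P 2) ^+ 2 - (P 1 - P 3) ^+ 2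
        = (a^* * b - a * b^*) * (a * b^* - a^* * b).
  rewrite !phiE !qform_real2 ?conj_opp ?conj_cos ?conj_sin //.
  have [[t u] v] := (sqrt2C_sq, cos8D_sq, state_norm).
  move: sqrt2C cos8D a b (a^*) (b^*) t u v => g d x y x' y' t u v.
  (* Replacing 1 by the squared norm of s to the power two makes both sides homogeneous of degree
     four, hence a polynomial identity. *)
  have n1 : (x * x' + y * y') * (x * x' + y * y') = 1 by rewrite v mulr1.
  by rewrite -[X in X - _ - _ = _]n1; field: t u.
have <- : (a^* * b - a * b^*)^* = a * b^* - a^* * b.
  by rewrite conjcB !conjcM /= !conjcK.
exact: mulcJ_ge0.
Qed.

End Bloch.

Definition amp (m : nat) (a : 'I_2) : C := phi R m a 0.

(** Stated as a product of equations so that the eight values serve as one rewrite rule. *)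
Lemma ampE :
  ((amp 0 0 = cos8D / 2) * (amp 0 1 = (sqrt2C - 1) * cos8D / 2)
   * (amp 1 0 = (sqrt2C - 1) * cos8D / 2) * (amp 1 1 = cos8D / 2)
   * (amp 2 0 = - ((sqrt2C - 1) * cos8D / 2)) * (amp 2 1 = cos8D / 2)
   * (amp 3 0 = - (cos8D / 2)) * (amp 3 1 = (sqrt2C - 1) * cos8D / 2))%type.
Proof. by rewrite /amp !phiE; do !split; rewrite mxE. Qed.

Lemma amp_mod m n a : m = n %[mod 4] -> amp m a = amp n a.
Proof. by rewrite /amp => /phi_mod ->. Qed.

Lemma conj_amp m a : (amp m a)^* = amp m a.
Proof.
rewrite (@amp_mod m (m %% 4)) ?modn_mod //.
have := ltn_pmod m (isT : 0 < 4)%N.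
case: (m %% 4)%N => [|[|[|[|//]]]] _; move: a; apply: ord2P;
  by rewrite ampE ?conj_opp ?conj_cos ?conj_sin.
Qed.

Lemma phi_pairE m a b : phi_pair m (idxAB a b) 0 = amp m a * amp m b.
Proof. exact: tens_cvE. Qed.

(** * Summing over Alice's rotation k *)

Section Cyclic.
Variables f g : nat -> C.
Hypothesis f_mod : forall m n, m = n %[mod 4] -> f m = f n.
Hypothesis g_mod : forall m n, m = n %[mod 4] -> g m = g n.

(** Here f stands for Eve's [weight] and g for Bob's [overlap]. Since k runs over a full period, the
    sum depends only on n - m modulo 4. *)
Definition rate m n : C := \sum_(k < 4) f (m + 4 - k) * (g (n + 4 - k) / 2).

Lemma rateE m n : rate m n =
  (f m * g n + f (m + 3) * g (n + 3) + f (m + 2) * g (n + 2) + f (m + 1) * g (n + 1)) / 2.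
Proof.
rewrite /rate sum4 !mulrA -!mulrDl.
have E k : (k + 4 - 0 = k %[mod 4])%N by rewrite subn0 modnDr.
have W (k : 'I_4) l : (l + 4 - k = l + (4 - k))%N by rewrite addnBA // ltnW.
rewrite (f_mod (E m)) (g_mod (E n)).
by congr ((_ + _ + _ + _) / _); congr (f _ * g _); rewrite -addnBA.
Qed.

Lemma rate_eq m n m1 m2 m3 n1 n2 n3 :
  m1 = m + 1 %[mod 4] -> m2 = m + 2 %[mod 4] -> m3 = m + 3 %[mod 4] ->
  n1 = n + 1 %[mod 4] -> n2 = n + 2 %[mod 4] -> n3 = n + 3 %[mod 4] ->
  rate m n = (f m * g n + f m3 * g n3 + f m2 * g n2 + f m1 * g n1) / 2.
Proof.
move=> M1 M2 M3 N1 N2 N3.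
by rewrite rateE (f_mod M1) (f_mod M2) (f_mod M3) (g_mod N1) (g_mod N2) (g_mod N3).
Qed.

(** Both error entries have index shift 2, so they are equal and their sum absorbs the factor
    1/2. *)
Lemma rate_err :
  rate 0 2 + rate 1 3 = f 0 * g 2 + f 1 * g 3 + f 2 * g 0 + f 3 * g 1.
Proof.
rewrite (@rate_eq 0 2 1 2 3 3 0 1) // (@rate_eq 1 3 2 3 0 0 1 2) //.
by move: (f 0) (f 1) (f 2) (f 3) (g 0) (g 1) (g 2) (g 3) => *; field.
Qed.

(** The correct entries have shifts 3 and 1, so each f m gets the factor (g (m + 1) + g (m + 3)) / 2
    = 1/2. *)
Lemma rate_total : g 0 + g 2 = 1 -> g 1 + g 3 = 1 ->
  rate 0 3 + rate 0 2 + rate 1 3 + rate 1 2 =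
  f 0 * g 2 + f 1 * g 3 + f 2 * g 0 + f 3 * g 1 + (f 0 + f 1 + f 2 + f 3) / 2.
Proof.
rewrite (@rate_eq 0 2 1 2 3 3 0 1) // (@rate_eq 1 3 2 3 0 0 1 2) //.
rewrite (@rate_eq 0 3 1 2 3 0 1 2) // (@rate_eq 1 2 2 3 0 3 0 1) //.
move: (f 0) (f 1) (f 2) (f 3) (g 0) (g 1) (g 2) (g 3) => f0 f1 f2 f3 g0 g1 g2 g3.
move=> g02 g13.
have -> : g2 = 1 - g0 by rewrite -g02 addrC addKr.
have -> : g3 = 1 - g1 by rewrite -g13 addrC addKr.
by field.
Qed.

End Cyclic.

Section AttackRates.
Variables (J : nat) (M : 'I_J -> 'M[C]_(2 * 2)) (sigma : 'I_J -> 'cV[C]_2).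

Definition weight i m : C := qform (M i) (phi_pair m).
Definition overlap i m : C := qform (sigma i *m dag (sigma i)) (phi R m).

Lemma weight_mod i m n : m = n %[mod 4] -> weight i m = weight i n.
Proof. by move=> E; rewrite /weight /phi_pair (phi_mod E). Qed.

Lemma overlap_mod i m n : m = n %[mod 4] -> overlap i m = overlap i n.
Proof. by move=> E; rewrite /overlap (phi_mod E). Qed.

Lemma rho_rate (a b : 'I_2) :
  rhoAB M sigma (idxAB a b) (idxAB a b) = \sum_i rate (weight i) (overlap i) a (3 - b).
Proof. by rewrite rho_diag exchange_big. Qed.

Lemma rho_err : rhoAB M sigma (idxAB 0 1) (idxAB 0 1) + rhoAB M sigma (idxAB 1 0) (idxAB 1 0)
  = \sum_i (weight i 0 * overlap i 2 + weight i 1 * overlap i 3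
      + weight i 2 * overlap i 0 + weight i 3 * overlap i 1).
Proof.
rewrite !rho_rate -big_split; apply: eq_bigr => i _.
exact: (rate_err (@weight_mod i) (@overlap_mod i)).
Qed.

Lemma rho_trace : (forall i, is_state (sigma i)) ->
  \tr (rhoAB M sigma) =
  \sum_i (weight i 0 * overlap i 2 + weight i 1 * overlap i 3
    + weight i 2 * overlap i 0 + weight i 3 * overlap i 1
    + (weight i 0 + weight i 1 + weight i 2 + weight i 3) / 2).
Proof.
move=> st; rewrite /mxtrace sum22 !rho_rate -!big_split; apply: eq_bigr => i _.
exact: (rate_total (@weight_mod i) (@overlap_mod i) (overlap02 (st i)) (overlap13 (st i))).
Qed.

End AttackRates.

(** * The lower bound *)

(* The computation behind [attack_ge0], over scalars only: [F x y z] is the value of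
   Eve's operator at [x *: sym0 + y *: sym1 + z *: sym2], the [bij] being its matrix
   elements. With [x = p0 - p2] and [y = p1 - p3], it rests on
   2 |v|^2 + |w|^2 - 2 sqrt 2 v (x w1 + y w2)
   = (sqrt 2 v - x w1 - y w2)^2 + (y w1 - x w2)^2 + (1 - x^2 - y^2) |w|^2. *)
Lemma scalar_attack_ge0 (g p0 p1 p2 p3 q0 q1 q2 q3 u v : C)
    (b00 b01 b02 b10 b11 b12 b20 b21 b22 : C) :
  let F x y z := x * x * b00 + y * y * b11 + z * z * b22 + x * y * (b01 + b10)
    + x * z * (b02 + b20) + y * z * (b12 + b21) in
  g * g = 2 -> 0 <= g -> p0 + p2 = 1 -> p1 + p3 = 1 ->
  0 <= 1 - (p0 - p2) ^+ 2 - (p1 - p3) ^+ 2 ->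
  q0 = F (g / 2) (g / 2) 0 -> q2 = F (g / 2) (- (g / 2)) 0 ->
  q1 = F (g / 2) 0 (g / 2) -> q3 = F (g / 2) 0 (- (g / 2)) ->
  u = F g (p2 - p0) (p3 - p1) -> v = F 0 (- (p3 - p1)) (p2 - p0) ->
  0 <= u -> 0 <= v -> 0 <= b11 -> 0 <= b22 ->
  (3 - g) / 7 * (q0 * p2 + q1 * p3 + q2 * p0 + q3 * p1 + (q0 + q1 + q2 + q3) / 2)
  <= q0 * p2 + q1 * p3 + q2 * p0 + q3 * p1.
Proof.
move=> F t g0 p02 p13 r0 Q0 Q2 Q1 Q3 U V u0 v0 b1 b2.
rewrite -subr_ge0.
(* Here (4 + g) / 7 is 1 - e for e = (3 - g) / 7. In the bracket, [u] and [v] are M evaluated on the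
   first two squares, and the last term accounts for the defect 1 - x^2 - y^2. *)
have -> : q0 * p2 + q1 * p3 + q2 * p0 + q3 * p1 - (3 - g) / 7 *
   (q0 * p2 + q1 * p3 + q2 * p0 + q3 * p1 + (q0 + q1 + q2 + q3) / 2)
  = (4 + g) / 14 * (g / 2) *
    (u + v + (1 - (p0 - p2) ^+ 2 - (p1 - p3) ^+ 2) * (b11 + b22)).
  have E2 : p2 = 1 - p0 by rewrite -p02 addrC addKr.
  have E3 : p3 = 1 - p1 by rewrite -p13 addrC addKr.
  rewrite Q0 Q1 Q2 Q3 U V /F E2 E3.
  move: t; clear=> t.
  by field: t.
have n0 n : 0 <= (n%:R)^-1 :> C by rewrite invr_ge0 ler0n.
apply: mulr_ge0; first by rewrite !mulr_ge0 ?addr_ge0 ?ler0n ?n0.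
by rewrite !addr_ge0 // mulr_ge0 // addr_ge0.
Qed.

(** * Eve's operator on the symmetric subspace *)

Section OneOutcome.
Variable M : 'M[C]_(2 * 2).
Hypothesis M0 : psd M.

Definition bform (u v : 'cV[C]_(2 * 2)) : C := (dag u *m M *m v) 0 0.
Local Notation B := bform.

Lemma bformDl u u' v : B (u + u') v = B u v + B u' v.
Proof. by rewrite /B dagD !mulmxDl [LHS]mxE. Qed.

Lemma bformDr u v v' : B u (v + v') = B u v + B u v'.
Proof. by rewrite /B mulmxDr [LHS]mxE. Qed.

Lemma bformZl x u v : x^* = x -> B (x *: u) v = x * B u v.
Proof. by move=> xr; rewrite /B dagZ xr -!scalemxAl [LHS]mxE. Qed.

Lemma bformZr x u v : B u (x *: v) = x * B u v.
Proof. by rewrite /B -scalemxAr [LHS]mxE. Qed.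

Lemma qform_comb3 (u v w : 'cV[C]_(2 * 2)) x y z : x^* = x -> y^* = y -> z^* = z ->
  qform M (x *: u + y *: v + z *: w) =
  x * x * B u u + y * y * B v v + z * z * B w w + x * y * (B u v + B v u)
  + x * z * (B u w + B w u) + y * z * (B v w + B w v).
Proof.
move=> xr yr zr; rewrite -[LHS]/(B _ _) !bformDl !bformDr !bformZl // !bformZr.
move: (B u u) (B u v) (B u w) (B v u) (B v v) (B v w) (B w u) (B w v) (B w w).
by move=> *; ring.
Qed.

Lemma col22P (u v : 'cV[C]_(2 * 2)) :
  (forall a b, u (idxAB a b) 0 = v (idxAB a b) 0) -> u = v.
Proof.
move=> uv; apply/matrixP => i j; rewrite ord1.
by rewrite -(mxtens_unindexK i); case: (mxtens_unindex i).
Qed.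

Lemma tens_sq_sum_eq (u v u' v' : 'cV[C]_2) :
  (forall a b, u a 0 * u b 0 + v a 0 * v b 0 = u' a 0 * u' b 0 + v' a 0 * v' b 0) ->
  u *t u + v *t v = u' *t u' + v' *t v'.
Proof.
move=> E; apply: col22P => a b; apply: etrans (etrans (E a b) _); last first.
  by rewrite [RHS]mxE 2!tens_cvE.
by rewrite [LHS]mxE 2!tens_cvE.
Qed.

(** Both sides are the identity matrix read as a vector, being completeness relations of two real
    orthonormal bases. So the four pairs span three dimensions and share the direction [sym0]. *)
Lemma phi_pair_sum : phi_pair 0 + phi_pair 2 = phi_pair 1 + phi_pair 3.
Proof.
have [t u] := (sqrt2C_sq, cos8D_sq).
apply: tens_sq_sum_eq => a b.
change (amp 0 a * amp 0 b + amp 2 a * amp 2 b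
  = amp 1 a * amp 1 b + amp 3 a * amp 3 b).
by move: a b; apply: ord2P; apply: ord2P; rewrite !ampE;
  move: sqrt2C cos8D t u => g d t u; field: t u.
Qed.

(* An orthonormal basis of the symmetric subspace. *)
Definition sym0 : 'cV[C]_(2 * 2) := (sqrt2C / 2) *: (phi_pair 0 + phi_pair 2).
Definition sym1 : 'cV[C]_(2 * 2) := (sqrt2C / 2) *: (phi_pair 0 - phi_pair 2).
Definition sym2 : 'cV[C]_(2 * 2) := (sqrt2C / 2) *: (phi_pair 1 - phi_pair 3).

Lemma phi_pair_sym : [/\ phi_pair 0 = (sqrt2C / 2) *: sym0 + (sqrt2C / 2) *: sym1 + 0 *: sym2,
  phi_pair 2 = (sqrt2C / 2) *: sym0 + (- (sqrt2C / 2)) *: sym1 + 0 *: sym2,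
  phi_pair 1 = (sqrt2C / 2) *: sym0 + 0 *: sym1 + (sqrt2C / 2) *: sym2
  & phi_pair 3 = (sqrt2C / 2) *: sym0 + 0 *: sym1 + (- (sqrt2C / 2)) *: sym2].
Proof.
have p3 : phi_pair 3 = phi_pair 0 + phi_pair 2 - phi_pair 1.
  by rewrite phi_pair_sum addrC addKr.
have t := sqrt2C_sq.
rewrite /sym0 /sym1 /sym2 p3.
move: (phi_pair 0) (phi_pair 1) (phi_pair 2) sqrt2C t => w0 w1 w2 g t.
split; apply/matrixP => i j; rewrite !mxE;
move: (w0 i j) (w1 i j) (w2 i j) => a b c; by field: t.
Qed.

(** The scalar inequality applied to the matrix elements of M in the basis [sym0], [sym1], [sym2].
    Positivity of M at two combinations of these vectors, with real coefficients built from the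
    overlaps, makes [u] and [v] nonnegative. *)
Lemma attack_ge0 (p0 p1 p2 p3 : C) :
  p0^* = p0 -> p1^* = p1 -> p0 + p2 = 1 -> p1 + p3 = 1 ->
  0 <= 1 - (p0 - p2) ^+ 2 - (p1 - p3) ^+ 2 ->
  let q0 := qform M (phi_pair 0) in let q1 := qform M (phi_pair 1) in
  let q2 := qform M (phi_pair 2) in let q3 := qform M (phi_pair 3) in
  (3 - sqrt2C) / 7 * (q0 * p2 + q1 * p3 + q2 * p0 + q3 * p1 + (q0 + q1 + q2 + q3) / 2)
  <= q0 * p2 + q1 * p3 + q2 * p0 + q3 * p1 :> C.
Proof.
move=> p0r p1r p02 p13 r0.
have xr : (p2 - p0)^* = p2 - p0.
  by rewrite -(addrK p0 p2) [p2 + _]addrC p02 !conjcB conjc1 p0r.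
have yr : (p3 - p1)^* = p3 - p1.
  by rewrite -(addrK p1 p3) [p3 + _]addrC p13 !conjcB conjc1 p1r.
have z0 : (0 : C)^* = 0 := conjc0 R.
have g0 : 0 <= sqrt2C by rewrite /sqrt2C /rc ler0c sqrtr_ge0.
have [E0 E2 E1 E3] := phi_pair_sym.
cbv zeta; apply: (scalar_attack_ge0 sqrt2C_sq g0 p02 p13 r0 _ _ _ _
  (qform_comb3 sym0 sym1 sym2 conj_sqrt2C xr yr)
  (qform_comb3 sym0 sym1 sym2 z0 (conj_opp yr) xr)
  (M0 _) (M0 _) (M0 sym1) (M0 sym2)).
- by rewrite E0; exact: qform_comb3 conj_half_sqrt2C conj_half_sqrt2C z0.
- by rewrite E2; exact: qform_comb3 conj_half_sqrt2C conj_opp_half_sqrt2C z0.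
- by rewrite E1; exact: qform_comb3 conj_half_sqrt2C z0 conj_half_sqrt2C.
- by rewrite E3; exact: qform_comb3 conj_half_sqrt2C z0 conj_opp_half_sqrt2C.
Qed.

End OneOutcome.

Lemma outcome_ge0 (M : 'M[C]_(2 * 2)) (s : 'cV[C]_2) : psd M -> is_state s ->
  let p m := qform (s *m dag s) (phi R m) in
  let q m := qform M (phi_pair m) in
  (3 - sqrt2C) / 7 * (q 0 * p 2 + q 1 * p 3 + q 2 * p 0 + q 3 * p 1
                  + (q 0 + q 1 + q 2 + q 3) / 2)
  <= q 0 * p 2 + q 1 * p 3 + q 2 * p 0 + q 3 * p 1 :> C.
Proof.
move=> M0 s1.
have real m : (qform (s *m dag s) (phi R m))^* = qform (s *m dag s) (phi R m).
  by rewrite qform_rank1 conjcM /= conjcK mulrC.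
exact: (attack_ge0 M0 (real 0) (real 1) (overlap02 s1) (overlap13 s1) (bloch s1)).
Qed.

(** Errors and trace are both sums over Eve's outcomes, so the linear inequality for each outcome
    adds up, and the positive trace can be divided out. *)
Lemma error_rate_ge (J : nat) (M : 'I_J -> 'M[C]_(2 * 2))
    (sigma : 'I_J -> 'cV[C]_2) :
  (forall i, psd (M i)) -> (forall i, is_state (sigma i)) ->
  0 < \tr (rhoAB M sigma) -> rc ((3 - Num.sqrt 2) / 7) <= ebit (rhoAB M sigma).
Proof.
move=> M0 s1 tr0; rewrite /ebit ler_pdivlMr // rho_err rho_trace //.
rewrite rcM rcV rcB !rc_nat -/sqrt2C mulr_sumr.
by apply: ler_sum => i _; exact: outcome_ge0.
Qed.

(** * The optimal measurement *)

Lemma dot2 (u v : 'cV[C]_2) : (dag u *m v) 0 0 = (u 0 0)^* * v 0 0 + (u 1 0)^* * v 1 0.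
Proof. by rewrite mxE sum2 /dag !mxE. Qed.

Lemma dot22 (u v : 'cV[C]_(2 * 2)) : (dag u *m v) 0 0 =
  (u (idxAB 0 0) 0)^* * v (idxAB 0 0) 0 + (u (idxAB 0 1) 0)^* * v (idxAB 0 1) 0
  + (u (idxAB 1 0) 0)^* * v (idxAB 1 0) 0 + (u (idxAB 1 1) 0)^* * v (idxAB 1 1) 0.
Proof. by rewrite mxE sum22 /dag !mxE. Qed.

Lemma tens_sub_entry (u v u' v' : 'cV[C]_2) a b :
  (u *t v - u' *t v') (idxAB a b) 0 = u a 0 * v b 0 - u' a 0 * v' b 0.
Proof. by rewrite [LHS]mxE [X in _ + X]mxE 2!tens_cvE. Qed.

Lemma dot_comb n (u v w : 'cV[C]_n) x y :
  (dag u *m (x *: v + y *: w)) 0 0 = x * (dag u *m v) 0 0 + y * (dag u *m w) 0 0.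
Proof.
rewrite mulmxDr -!scalemxAr.
by rewrite [LHS]mxE; congr (_ + _); rewrite [LHS]mxE.
Qed.

Lemma singlet_eq_gen (u v u' v' : 'cV[C]_2) :
  (forall a b, u a 0 * v b 0 - v a 0 * u b 0 = - (u' a 0 * v' b 0 - v' a 0 * u' b 0)) ->
  u *t v - v *t u = - (u' *t v' - v' *t u').
Proof.
by move=> E; apply: col22P => a b; rewrite [RHS]mxE 2!tens_sub_entry.
Qed.

Lemma outerN n (u : 'cV[C]_n) : (- u) *m dag (- u) = u *m dag u.
Proof. by rewrite dagN mulNmx mulmxN opprK. Qed.

(** Antisymmetric vectors are orthogonal to symmetric ones; this is why the outcome vac never occurs
    on the signal pairs. *)
Lemma antisym_pair (u v w : 'cV[C]_2) :
  dag (u *t v - v *t u) *m (w *t w) = 0 :> 'M[C]_(1, 1).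
Proof.
apply/matrixP => i j; rewrite !ord1 dot22 4!tens_sub_entry 4!tens_cvE [RHS]mxE.
rewrite !(conjcB, conjcM).
move: (w 0 0) (w 1 0) (u 0 0)^* (u 1 0)^* (v 0 0)^* (v 1 0)^* => w0 w1 u0 u1 v0 v1.
by ring.
Qed.

Lemma sum_outer_entry n a (w : 'cV[C]_n) (c : 'I_4 -> 'cV[C]_n) i j :
  (a *: (w *m dag w) + \sum_(m < 4) c m *m dag (c m)) i j =
  a * (w i 0 * (w j 0)^*) + (c 0 i 0 * (c 0 j 0)^* + c 1 i 0 * (c 1 j 0)^* +
    c 2 i 0 * (c 2 j 0)^* + c 3 i 0 * (c 3 j 0)^*).
Proof. by rewrite [LHS]mxE summxE sum4 [X in X + _ = _]mxE !outer_entry. Qed.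

Lemma ord4P (P : 'I_4 -> Prop) : P 0 -> P 1 -> P 2 -> P 3 -> forall i, P i.
Proof.
move=> P0 P1 P2 P3 i; have E (j : 'I_4) : P j -> j = i :> nat -> P i.
  by move=> Pj /val_inj <-.
case: i E => [[|[|[|[|//]]]] ?] E.
- exact: (E _ P0).
- exact: (E _ P1).
- exact: (E _ P2).
- exact: (E _ P3).
Qed.

(* Keeps unification from comparing states by unfolding the matrices. *)
Local Opaque phi phi_pair amp dag.

Definition dotphi m n : C := amp m 0 * amp n 0 + amp m 1 * amp n 1.

Lemma dag_phi_phi m n : (dag (phi R m) *m phi R n) 0 0 = dotphi m n.
Proof. by rewrite dot2 -/(amp m 0) -/(amp m 1) !conj_amp. Qed.

Lemma phi_state (m : 'I_4) : is_state (phi R m).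
Proof.
rewrite /is_state dag_phi_phi; have [t u] := (sqrt2C_sq, cos8D_sq).
move: m; apply: ord4P; rewrite /dotphi /= !ampE;
by move: sqrt2C cos8D t u => g d t u; field: t u.
Qed.

Lemma conj_phi_pair m a b : (phi_pair m (idxAB a b) 0)^* = amp m a * amp m b.
Proof. by rewrite phi_pairE conjcM !conj_amp. Qed.

Lemma dag_phi_pair_phi_pair m n : (dag (phi_pair m) *m phi_pair n) 0 0 = dotphi m n * dotphi m n.
Proof.
rewrite dot22 !conj_phi_pair !phi_pairE /dotphi.
by move: (amp m 0) (amp m 1) (amp n 0) (amp n 1) => *; ring.
Qed.

Lemma lamE : lam_p R = (2 + sqrt2C) / 4 /\ lam_m R = (sqrt2C - 2) / 4.
Proof.
have E n : rc (n%:R)^-1 = (n%:R)^-1 :> C by rewrite rcV rc_nat.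
by split; rewrite /lam_p /lam_m rcM E; [rewrite rcD rc_nat|rewrite addrC rcB rc_nat].
Qed.

Lemma chiE (m : nat) (a b : 'I_2) : chi R m (idxAB a b) 0 =
  (2 + sqrt2C) / 4 * (amp m a * amp m b)
  + (sqrt2C - 2) / 4 * (amp (m + 2) a * amp (m + 2) b).
Proof.
have [L1 L2] := lamE; rewrite -L1 -L2 -!phi_pairE /chi.
by rewrite [LHS]mxE; congr (_ + _); rewrite [LHS]mxE.
Qed.

Lemma chi_real m i : (chi R m i 0)^* = chi R m i 0.
Proof.
have [L1 L2] := lamE.
have r1 : ((2 + sqrt2C) / 4)^* = (2 + sqrt2C) / 4 by rewrite -L1 conjc_rc.
have r2 : ((sqrt2C - 2) / 4)^* = (sqrt2C - 2) / 4 by rewrite -L2 conjc_rc.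
rewrite -(mxtens_unindexK i); case: (mxtens_unindex i) => a b.
rewrite -/(idxAB a b) chiE.
by apply: conj_comb => //; rewrite ?conj_amp.
Qed.

Lemma dag_phi_pair_chi m n : (dag (phi_pair m) *m chi R n) 0 0 =
  (2 + sqrt2C) / 4 * (dotphi m n * dotphi m n)
  + (sqrt2C - 2) / 4 * (dotphi m (n + 2) * dotphi m (n + 2)).
Proof.
have [<- <-] := lamE; rewrite /chi dot_comb.
by congr (_ * _ + _ * _); exact: dag_phi_pair_phi_pair.
Qed.

Lemma singletE (m n : nat) (a b : 'I_2) :
  (phi R m *t phi R n - phi R n *t phi R m) (idxAB a b) 0 =
  amp m a * amp n b - amp n a * amp m b.
Proof. exact: tens_sub_entry. Qed.

(** The antisymmetric subspace is a line, on which u, v give det(u, v) times the singlet; the two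
    determinants are 1 and -1. *)
Lemma singlet_eq : phi R 0 *t phi R 2 - phi R 2 *t phi R 0 =
  - (phi R 3 *t phi R 1 - phi R 1 *t phi R 3).
Proof.
have [t d2] := (sqrt2C_sq, cos8D_sq).
apply: singlet_eq_gen => a b.
change (amp 0 a * amp 2 b - amp 2 a * amp 0 b
  = - (amp 3 a * amp 1 b - amp 1 a * amp 3 b)).
move: a b; apply: ord2P; apply: ord2P; rewrite !ampE;
by move: sqrt2C cos8D t d2 => g d t d2; field: t d2.
Qed.

Lemma Mvac_optE : Mvac_opt R = Mvac_opt' R.
Proof. by rewrite /Mvac_opt singlet_eq outerN. Qed.

Lemma conj_singlet m n a b :
  ((phi R m *t phi R n - phi R n *t phi R m) (idxAB a b) 0)^* =
  amp m a * amp n b - amp n a * amp m b.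
Proof. by rewrite singletE; apply: conj_sub_mul; exact: conj_amp. Qed.

Lemma Mvac_opt_phi_pair m : dag (phi_pair m) *m Mvac_opt R *m phi_pair m = 0.
Proof.
rewrite /Mvac_opt -scalemxAr -scalemxAl -!mulmxA.
by rewrite (antisym_pair (phi R 0) (phi R 2) (phi R m)) !mulmx0 scaler0.
Qed.

(** In the basis [sym0], [sym1], [sym2] the four [chi] are (1/2, +-1/sqrt 2, 0) and (1/2, 0,
    +-1/sqrt 2), whose projectors sum to the symmetric projector; [Mvac_opt] is the projector on the
    singlet. *)
Lemma povm_sum : Mvac_opt R + \sum_(i < 4) M_opt R i = 1%:M.
Proof.
have [t d2] := (sqrt2C_sq, cos8D_sq).
have A4 a : amp (2 + 2) a = amp 0 a by exact: amp_mod.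
have A5 a : amp (3 + 2) a = amp 1 a by exact: amp_mod.
have id_eq x : (1%:M : 'M[C]_(2 * 2)) x x = 1 by rewrite mxE eqxx.
have id_neq x y : x != y -> (1%:M : 'M[C]_(2 * 2)) x y = 0.
  by rewrite mxE => /negbTE ->.
(* Packing the entries existentially leaves opaque functions with known values, so the entrywise
   computation never meets [chi] or the tensor products. *)
have [X [XE XF]] : exists X : nat -> 'I_2 -> 'I_2 -> C,
    (forall m a b, chi R m (idxAB a b) 0 = X m a b) /\
    (forall m a b, X m a b = (2 + sqrt2C) / 4 * (amp m a * amp m b)
       + (sqrt2C - 2) / 4 * (amp (m + 2) a * amp (m + 2) b)).
  by exists (fun m a b => chi R m (idxAB a b) 0); split=> // m a b; exact: chiE.
have [Y [YE YF]] : exists Y : 'I_2 -> 'I_2 -> C,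
    (forall a b, (phi R 0 *t phi R 2 - phi R 2 *t phi R 0) (idxAB a b) 0 = Y a b) /\
    (forall a b, Y a b = amp 0 a * amp 2 b - amp 2 a * amp 0 b).
  by exists (fun a b => (phi R 0 *t phi R 2 - phi R 2 *t phi R 0) (idxAB a b) 0);
    split=> // a b; exact: singletE.
have Yr a b : (Y a b)^* = Y a b by rewrite -YE conj_singlet singletE.
have Xr m a b : (chi R m (idxAB a b) 0)^* = X m a b by rewrite chi_real XE.
have E a b c d : (Mvac_opt R + \sum_(i < 4) M_opt R i) (idxAB a b) (idxAB c d) =
  2^-1 * (Y a b * Y c d) + (X 0%N a b * X 0%N c d + X 1%N a b * X 1%N c d
    + X 2%N a b * X 2%N c d + X 3%N a b * X 3%N c d).
  apply: etrans (sum_outer_entry _ _ _ _ _) _.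
  rewrite (YE a b) (YE c d) Yr; congr (_ + _).
  congr (_ * _ + _ * _ + _ * _ + _ * _);
    [exact: (XE 0%N)|exact: (Xr 0%N)|exact: (XE 1%N)|exact: (Xr 1%N)
    |exact: (XE 2%N)|exact: (Xr 2%N)|exact: (XE 3%N)|exact: (Xr 3%N)].
apply/matrixP => i j.
rewrite -(mxtens_unindexK i) -(mxtens_unindexK j).
case: (mxtens_unindex i) (mxtens_unindex j) => a b [c d].
rewrite -/(idxAB a b) -/(idxAB c d) E !XF !YF !A4 !A5.
move: a b c d; do 4!apply: ord2P; rewrite !ampE ?id_eq ?id_neq //;
 clear -t d2; move: sqrt2C cos8D t d2 => g d t d2.
all: by field: t d2.
Qed.

Lemma M_opt_povm : is_povm (Mvac_opt R) (@M_opt R).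
Proof.
split; first by apply: psd_scale; [rewrite invr_ge0 ler0n | exact: psd_rank1].
by split; [move=> i; exact: psd_rank1 | exact: povm_sum].
Qed.

(** * Rates induced by the optimal attack *)

Lemma nat4P (P : nat -> Prop) : P 0 -> P 1 -> P 2 -> P 3 -> forall n, (n < 4)%N -> P n.
Proof. by move=> P0 P1 P2 P3 [|[|[|[|]]]]. Qed.

(* |<phi_m|phi_n>|^2 for [same] the test [m = n] and [odd] the parity of [m + n]. *)
Definition overlap_sq (same odd : bool) : C := if same then 1 else if odd then 2^-1 else 0.

Lemma overlap_sqE :
  ((forall b, overlap_sq true b = 1) * (overlap_sq false true = 2^-1)
   * (overlap_sq false false = 0))%type.
Proof. by []. Qed.

Lemma dotphi_sqE m n : (m < 4)%N -> (n < 4)%N ->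
  dotphi m n * dotphi m n = overlap_sq (m == n) (odd (m + n)).
Proof.
have [t u] := (sqrt2C_sq, cos8D_sq).
move: m; apply: nat4P; move: n; apply: nat4P; rewrite /dotphi !ampE overlap_sqE;
by move: sqrt2C cos8D t u => g d t u; field: t u.
Qed.

Lemma overlap_opt (i m : nat) : (i < 4)%N -> (m < 4)%N ->
  qform (phi R i *m dag (phi R i)) (phi R m) = overlap_sq (m == i) (odd (m + i)).
Proof.
move=> i4 m4; rewrite -dotphi_sqE //; apply: qform_rank1_real (dag_phi_phi _ _) _.
by apply: conj_add_mul; exact: conj_amp.
Qed.

Lemma conj_overlap_sq b c : (overlap_sq b c)^* = overlap_sq b c.
Proof.
have r2 : (2^-1 : C)^* = 2^-1 by rewrite -(rc_nat 2) -rcV conjc_rc.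
by case: b => /=; [exact: conjc1|case: c => //=; exact: conjc0].
Qed.

Lemma weight_opt (i m : nat) : (i < 4)%N -> (m < 4)%N ->
  qform (chi R i *m dag (chi R i)) (phi_pair m) =
  ((2 + sqrt2C) / 4 * overlap_sq (m == i) (odd (m + i))
   + (sqrt2C - 2) / 4 * overlap_sq (m == (i + 2) %% 4)%N (odd (m + (i + 2) %% 4))) ^+ 2.
Proof.
move=> i4 m4; have m2 : ((i + 2) %% 4 < 4)%N by rewrite ltn_mod.
(* The index i + 2 may exceed 3, whereas [dotphi_sqE] compares indices below 4. *)
have D2 : dotphi m (i + 2) = dotphi m ((i + 2) %% 4).
  have A a : amp (i + 2) a = amp ((i + 2) %% 4) a by apply: amp_mod; rewrite modn_mod.
  by rewrite /dotphi !A.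
have [L1 L2] := lamE.
have r1 : ((2 + sqrt2C) / 4)^* = (2 + sqrt2C) / 4 by rewrite -L1 conjc_rc.
have r2 : ((sqrt2C - 2) / 4)^* = (sqrt2C - 2) / 4 by rewrite -L2 conjc_rc.
rewrite expr2; apply: qform_rank1_real.
  apply: etrans (dag_phi_pair_chi m i) _; congr (_ * _ + _ * _); first exact: dotphi_sqE.
  by rewrite D2; exact: dotphi_sqE.
by apply: conj_add_mul; [exact: r1|exact: conj_overlap_sq|exact: r2|exact: conj_overlap_sq].
Qed.

(** Equality case of the bound: for i = 0, [chi] has coordinates (1/2, 1/sqrt 2, 0) and r = (1, 0),
    so every term of the sum of squares vanishes; the other i are analogous. The weights are the
    squares of [lam_p] and [lam_m] at i and i + 2, and 1/8 at the two others. *)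
Lemma opt_err_summand (i : nat) : (i < 4)%N ->
  let q m := qform (chi R i *m dag (chi R i)) (phi_pair m) in
  let p m := qform (phi R i *m dag (phi R i)) (phi R m) in
  q 0 * p 2 + q 1 * p 3 + q 2 * p 0 + q 3 * p 1 = (2 - sqrt2C) / 4.
Proof.
move=> i4 q p; have Q m (m4 : (m < 4)%N) : q m = _ := weight_opt i4 m4.
have P m (m4 : (m < 4)%N) : p m = _ := overlap_opt i4 m4.
move: q p Q P => q p Q P; rewrite !Q // !P //.
have t := sqrt2C_sq; move: sqrt2C t {q p Q P} => g t.
move: i i4; apply: nat4P; rewrite !overlap_sqE; by field: t.
Qed.

Lemma opt_total_summand (i : nat) : (i < 4)%N ->
  let q m := qform (chi R i *m dag (chi R i)) (phi_pair m) in
  q 0 + q 1 + q 2 + q 3 = 1.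
Proof.
move=> i4 q; have Q m (m4 : (m < 4)%N) : q m = _ := weight_opt i4 m4.
move: q Q => q Q; rewrite !Q //.
have t := sqrt2C_sq; move: sqrt2C t {q Q} => g t.
move: i i4; apply: nat4P; rewrite !overlap_sqE; by field: t.
Qed.

Lemma opt_err : rhoAB (@M_opt R) (@sigma_opt R) (idxAB 0 1) (idxAB 0 1)
  + rhoAB (@M_opt R) (@sigma_opt R) (idxAB 1 0) (idxAB 1 0) = 2 - sqrt2C.
Proof.
rewrite rho_err; under eq_bigr => i _ do rewrite (opt_err_summand (ltn_ord i)).
by rewrite sum4; field.
Qed.

Lemma opt_trace : \tr (rhoAB (@M_opt R) (@sigma_opt R)) = 4 - sqrt2C.
Proof.
rewrite rho_trace; last by move=> i; exact: phi_state.
rewrite (eq_bigr (fun=> (2 - sqrt2C) / 4 + 1 / 2)); last first.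
  move=> i _; congr (_ + _ / _); [exact: (opt_err_summand (ltn_ord i))|].
  exact: (opt_total_summand (ltn_ord i)).
by rewrite sum4; field.
Qed.

Lemma opt_trace_gt0 : 0 < 4 - sqrt2C :> C.
Proof.
rewrite /sqrt2C -(rc_nat 4) -rcB /rc ltcR subr_gt0.
have := sqrt2_sq; have := sqrtr_ge0 (2 : R); nra.
Qed.

Lemma opt_ebit : ebit (rhoAB (@M_opt R) (@sigma_opt R)) = rc ((3 - Num.sqrt 2) / 7).
Proof.
rewrite /ebit opt_err opt_trace rcM rcV rcB !rc_nat -/sqrt2C.
have n0 : 4 - sqrt2C != 0 by apply: lt0r_neq0; exact: opt_trace_gt0.
apply: (canLR (mulfK n0)).
by have t := sqrt2C_sq; move: sqrt2C t {n0} => g t; field: t.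
Qed.

End TwoPhotonSARG04.

Theorem theorem5 (R : realType) :
  (* lower bound: every POVM attack induces e_b >= (3 - sqrt 2)/7 *)
  (forall (J : nat) (Mvac : 'M[R[i]]_(2 * 2)) (M : 'I_J -> 'M[R[i]]_(2 * 2))
          (sigma : 'I_J -> 'cV[R[i]]_2),
      is_povm Mvac M ->
      (forall i, is_state (sigma i)) ->
      0 < \tr (rhoAB M sigma) ->
      rc ((3 - Num.sqrt 2) / 7) <= ebit (rhoAB M sigma))
  /\
  (* attainment by the explicit J = 4 POVM with sigma_m = phi_m *)
  (is_povm (Mvac_opt R) (@M_opt R)
   /\ Mvac_opt R = Mvac_opt' R
   /\ (forall m : 'I_4, is_state (sigma_opt R m))
   /\ (forall m : 'I_4,
         dag (phi R m *t phi R m) *m Mvac_opt R *m (phi R m *t phi R m) = 0)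
   /\ 0 < \tr (rhoAB (@M_opt R) (@sigma_opt R))
   /\ ebit (rhoAB (@M_opt R) (@sigma_opt R)) = rc ((3 - Num.sqrt 2) / 7)).
Proof.
split=> [J Mvac M sigma [_ [M0 _]] s1 tr0|]; first exact: (@error_rate_ge R J M sigma).
split; first exact: M_opt_povm.
split; first exact: Mvac_optE.
split; first exact: phi_state.
split; first by move=> m; exact: (Mvac_opt_phi_pair R m).
by rewrite opt_trace; split; [exact: opt_trace_gt0 | exact: opt_ebit].
Qed.
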